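(* Consider the closed chain of $N$ contours with $2m$ cells and a cluster of $l$ particles on each contour (dynamics in the context). If $N$ is even and $l\le \frac{2m}{N}$, then the system results in a state of free movement from any admissible initial state.
   Context: Closed chain of contours. Integers $N\ge 2$, $m\ge 1$, $1\le l<2m$. Contours are indexed by $i\in\mathbb{Z}/N$ (arithmetic of contour indices is modulo $N$); each contour has $2m$ cells indexed $0,1,\dots,2m-1$ in the direction of movement (arithmetic of cells is modulo $2m$) and one cluster of $l$ particles in consecutive cells. The state $x_i(t)\in\{0,\dots,2m-1\}$ of contour $i$ at time $t$ is the cell of the leading particle of its cluster (cluster $i$); the system state is $(x_0(t),\dots,x_{N-1}(t))$. Contours $i$ and $i+1$ share the node $(i,i+1)$, located between cells $0,1$ of contour $i$ and between cells $m,m+1$ of contour $i+1$. Cluster $i$ occupies node $(i,i+1)$ if $x_i\in\{1,\dots,l-1\}$; cluster $i$ occupies node $(i-1,i)$ if $x_i\in\{m+1,\dots,m+l-1\}$ modulo $2m$. A state is admissible if no node is occupied by two clusters; only admissible states are considered. Dynamics ($t\to t+1$, all clusters simultaneously): $x_i(t+1)=x_i(t)+1 \bmod 2m$ unless cluster $i$ is delayed at time $t$, in which case $x_i(t+1)=x_i(t)$. Cluster $i$ is delayed at time $t$ iff either $x_i(t)=0$ and cluster $i+1$ occupies node $(i,i+1)$; or $x_i(t)=m$ and cluster $i-1$ occupies node $(i-1,i)$; or $x_i(t)=m$ and $x_{i-1}(t)=0$ (left-priority rule). The system is in a state of free movement at time $t_0$ if at every time $t\ge t_0$ every cluster moves without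 delay. ''Results in'' means: reaches such a state at some finite time. *)

(* Defs.v *)
From mathcomp Require Export all_boot all_order all_algebra.

Set Implicit Arguments.
Unset Strict Implicit.
Unset Printing Implicit Defensive.

(* Contours are ['I_N] and cells are ['I_(2 * m)]; [ordS] and [ord_pred] are the
   cyclic successor and predecessor, so [ordS i] is contour i + 1 modulo N and
   [ordS c] is cell c + 1 modulo 2m. A state gives the cell of the leading
   particle of each cluster. *)
Definition state (N m : nat) : Type := {ffun 'I_N -> 'I_(2 * m)}.

(* Cluster [i] occupies node (i, i + 1). *)
Definition occupies_next (N m l : nat) (x : state N m) (i : 'I_N) : bool :=
  0 < x i < l.

(* Cluster [i] occupies node (i - 1, i): its leading particle is in one of the
   cells m + 1, ..., m + l - 1, reduced modulo 2m. *)
Definition occupies_prev (N m l : nat) (x : state N m) (i : 'I_N) : bool :=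
  (x i : nat) \in [seq k %% (2 * m) | k <- iota m.+1 l.-1].

(* Only clusters i and i + 1 can occupy node (i, i + 1). For N = 2 the nodes
   (0, 1) and (1, 0) are distinct. *)
Definition admissible (N m l : nat) (x : state N m) : bool :=
  [forall i, ~~ (occupies_next l x i && occupies_prev l x (ordS i))].

(* The last disjunct is the left-priority rule. *)
Definition delayed (N m l : nat) (x : state N m) (i : 'I_N) : bool :=
  [|| (x i == 0 :> nat) && occupies_prev l x (ordS i),
      (x i == m :> nat) && occupies_next l x (ord_pred i)
    | (x i == m :> nat) && (x (ord_pred i) == 0 :> nat)].

Definition step (N m l : nat) (x : state N m) : state N m :=
  [ffun i => if delayed l x i then x i else ordS (x i)].

Definition state_at (N m l : nat) (x : state N m) (t : nat) : state N m :=
  iter t (step l) x.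

Definition free_movement_at (N m l : nat) (x : state N m) (t0 : nat) : Prop :=
  forall t : nat, t0 <= t -> forall i : 'I_N, ~~ delayed l (state_at l x t) i.

(* Main.v *)
(* For each edge j = (j, j + 1) let the gap D_j be x_(j+1) + m - x_j modulo 2m,
   taken in [1, 2m]. The node (j, j + 1) causes no further wait when
   l <= D_j <= 2m - l; the defect of the edge is the distance of D_j from this
   interval. A wait at a node lowers the defect of its edge by one and changes the
   defect of one neighbouring edge by at most one, so the total defect never
   increases. Once it is constant, every wait passes a unit of defect on: to the
   left when the gap is small (D_j <= l), to the right when it is large
   (D_j >= 2m - l), and a gap can leave [1, 2m] only by falling from 1 to 0, which
   is represented by 2m. The sum of the gaps is then nondecreasing and bounded,
   so it too is eventually constant and no gap wraps around any more. From then on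
   small gaps stay small and large gaps stay large, so one further wait would
   travel around the whole chain and make all gaps small or all gaps large. Both
   are impossible, because N l <= 2m and, N being even, the sum of the gaps is a
   multiple of 2m. *)

Require Import Defs.
From mathcomp Require Import all_boot all_order all_algebra.
From mathcomp Require Import zify.
From Stdlib Require Import Classical_Prop.

Import Order.TTheory GRing.Theory Num.Theory.

Set Implicit Arguments.
Unset Strict Implicit.
Unset Printing Implicit Defensive.

(* The representative in [1, 2m] of b + m - a modulo 2m. *)
Definition gap_nat (m a b : nat) : nat :=
  if b + m <= a then b + m + 2 * m - a
  else if b + m - a <= 2 * m then b + m - a else b + m - a - 2 * m.

Definition succ_mod (n a : nat) : nat := if a.+1 == n then 0 else a.+1.

Lemma gap_nat_bounds m a b : a < 2 * m -> b < 2 * m -> 0 < gap_nat m a b <= 2 * m.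
Proof. by rewrite /gap_nat; do !case: ifP; lia. Qed.

Lemma gap_nat_succ2 m a b : a < 2 * m -> b < 2 * m ->
  gap_nat m (succ_mod (2 * m) a) (succ_mod (2 * m) b) = gap_nat m a b.
Proof. by rewrite /gap_nat /succ_mod; do !case: ifP; lia. Qed.

Lemma gap_nat_succr m a b : a < 2 * m -> b < 2 * m ->
  gap_nat m a (succ_mod (2 * m) b) =
  if gap_nat m a b == 2 * m then 1 else (gap_nat m a b).+1.
Proof. by rewrite /gap_nat /succ_mod; do !case: ifP; lia. Qed.

Lemma gap_nat_succl m a b : a < 2 * m -> b < 2 * m ->
  gap_nat m (succ_mod (2 * m) a) b =
  if gap_nat m a b == 1 then 2 * m else (gap_nat m a b).-1.
Proof. by rewrite /gap_nat /succ_mod; do !case: ifP; lia. Qed.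

Lemma gap_nat_mod m a b : a < 2 * m -> b < 2 * m ->
  gap_nat m a b + a = b + m %[mod 2 * m].
Proof.
move=> ha hb; rewrite /gap_nat.
case: ifP => h1; last case: ifP => h2.
- have ->: b + m + 2 * m - a + a = b + m + 2 * m by lia.
  by rewrite modnDr.
- by have ->: b + m - a + a = b + m by lia.
- have E : b + m = b + m - a - 2 * m + a + 2 * m by lia.
  by rewrite [in RHS]E modnDr.
Qed.

(* The left-priority rule applies at gap 0, which counts as 2m and so has the full
   defect l on the side of the waits of the right-hand cluster. *)
Definition defect_nat (l m D : nat) : nat := (l - D) + (D - (2 * m - l)).

Definition gap (N m : nat) (x : state N m) (j : 'I_N) : nat :=
  gap_nat m (x j) (x (ordS j)).

Definition waits_next (N m l : nat) (x : state N m) (i : 'I_N) : bool :=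
  (x i == 0 :> nat) && (m < x (ordS i) < m + l).

(* The bound also covers x (ord_pred i) = 0, the left-priority rule. *)
Definition waits_prev (N m l : nat) (x : state N m) (i : 'I_N) : bool :=
  (x i == m :> nat) && (x (ord_pred i) < l).

(** * Waits and gaps in one step *)

Section Dynamics.
Context (N m l : nat) (l_gt0 : 0 < l) (le_lm : l <= m).
Implicit Types (x : state N m) (i j : 'I_N).

(** Since [l <= m], the cells up to [m + l - 1] lie below [2 * m], so the reduction has no
    effect. *)
Lemma occupies_prevE x i : occupies_prev l x i = (m < x i < m + l).
Proof.
rewrite /occupies_prev.
have -> : [seq k %% (2 * m) | k <- iota m.+1 l.-1] = iota m.+1 l.-1.
  rewrite -[RHS]map_id; apply/eq_in_map => k; rewrite mem_iota => hk.
  by rewrite modn_small //; lia.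
by rewrite mem_iota; lia.
Qed.

Lemma delayedE x i : delayed l x i = waits_next l x i || waits_prev l x i.
Proof.
rewrite /delayed /waits_next /waits_prev occupies_prevE /occupies_next.
by lia.
Qed.

Lemma val_step x i :
  step l x i = (if delayed l x i then x i : nat else succ_mod (2 * m) (x i)) :> nat.
Proof.
rewrite /step ffunE; case: ifP => // _ /=; rewrite /succ_mod.
have := ltn_ord (x i); case: eqP => [-> _|ne h]; first by rewrite modnn.
by rewrite modn_small //; lia.
Qed.

Lemma gap_bounds x j : 0 < gap x j <= 2 * m.
Proof. exact: gap_nat_bounds. Qed.

Lemma gap_step x j : gap (step l x) j =
  if delayed l x j == delayed l x (ordS j) then gap x j
  else if delayed l x j then (if gap x j == 2 * m then 1 else (gap x j).+1)
  else (if gap x j == 1 then 2 * m else (gap x j).-1).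
Proof.
rewrite /gap !val_step.
have ha := ltn_ord (x j); have hb := ltn_ord (x (ordS j)).
case: (delayed l x j); case: (delayed l x (ordS j)) => //=.
- exact: gap_nat_succr.
- exact: gap_nat_succl.
- exact: gap_nat_succ2.
Qed.

Lemma waits_next_gap x j : waits_next l x j -> gap x j < l.
Proof. by rewrite /waits_next /gap /gap_nat; do !case: ifP; lia. Qed.

Lemma waits_prev_gap x j : waits_prev l x (ordS j) -> 2 * m - l < gap x j.
Proof. by rewrite /waits_prev /gap /gap_nat ordSK; do !case: ifP; lia. Qed.

Lemma gap_waits_next x j : gap x j < l -> x j = 0 :> nat -> waits_next l x j.
Proof.
have := ltn_ord (x (ordS j)).
by rewrite /waits_next /gap /gap_nat; do !case: ifP; lia.
Qed.

Lemma gap_waits_prev x j :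
  2 * m - l < gap x j -> x (ordS j) = m :> nat -> waits_prev l x (ordS j).
Proof.
have := ltn_ord (x j).
by rewrite /waits_prev /gap /gap_nat ordSK; do !case: ifP; lia.
Qed.

(** A blocking cluster always moves: it is strictly inside the node, away from cells [0] and [m], or
    it is at cell [0] with priority. *)
Lemma waits_excl x j : [/\ ~~ (waits_next l x j && waits_prev l x j),
  waits_next l x j -> ~~ delayed l x (ordS j) &
  waits_prev l x (ordS j) -> ~~ delayed l x j].
Proof.
by rewrite !delayedE /waits_next /waits_prev ordSK; split; lia.
Qed.

(** * Total defect and its equality case *)

Definition defect x j := defect_nat l m (gap x j).

Ltac edge_cases x j :=
  have := @waits_next_gap x j; have := @waits_prev_gap x j;
  have := gap_bounds x j; have [] := waits_excl x j;
  have [] := waits_excl x (ordS j);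
  rewrite !delayedE /defect_nat; move: (gap x j) => D;
  by case: (waits_next l x j); case: (waits_prev l x j);
    case: (waits_next l x (ordS j)); case: (waits_prev l x (ordS j)) => /=;
    do ?case: eqP => ?; lia.

(* Summed over [j], the waits cancel: each one is counted on the left for the edge
   of its node and on the right for the other edge of the same contour. *)
Lemma defect_step x j :
  defect (step l x) j + waits_next l x j + waits_prev l x (ordS j)
  <= defect x j + waits_prev l x j + waits_next l x (ordS j).
Proof.
rewrite /defect gap_step.
edge_cases x j.
Qed.

Definition tight x : bool := [forall j,
  defect (step l x) j + waits_next l x j + waits_prev l x (ordS j)
  == defect x j + waits_prev l x j + waits_next l x (ordS j)].

(** The unit of defect lost at edge [ordS j] must reappear at edge [j], and lowering a gap raises
    its defect only if the gap is at most [l]. *)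
Lemma tight_waits_next x j : tight x -> waits_next l x (ordS j) ->
  gap x j <= l /\ ~~ delayed l x j.
Proof.
move=> /forallP/(_ j)/eqP; rewrite /defect gap_step.
edge_cases x j.
Qed.

(** Mirror image; the gap [2 * m] is excluded because its wrap to [1] lowers the defect. *)
Lemma tight_waits_prev x j : tight x -> waits_prev l x j ->
  2 * m - l <= gap x j < 2 * m /\ ~~ delayed l x (ordS j).
Proof.
move=> /forallP/(_ j)/eqP; rewrite /defect gap_step.
edge_cases x j.
Qed.

(** Tightness excludes the wrap from [2 * m] to [1]; the inequality is strict only at a wrap from
    [1] to [2 * m]. *)
Lemma tight_gap_step x j : tight x ->
  gap x j + delayed l x j <= gap (step l x) j + delayed l x (ordS j).
Proof.
move=> tx; rewrite gap_step.
have := @tight_waits_next x j tx; have := @tight_waits_prev x j tx.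
have := @waits_next_gap x j; have := gap_bounds x j.
rewrite !delayedE.
move: (gap x j) => D.
by case: (waits_next l x j); case: (waits_prev l x j);
  case: (waits_next l x (ordS j)); case: (waits_prev l x (ordS j)) => /=;
  do ?case: eqP => ?; lia.
Qed.

Lemma sum_ordS (F : 'I_N -> nat) : \sum_j F (ordS j) = \sum_j F j.
Proof. by rewrite [RHS](reindex_inj (can_inj (@ordSK N))). Qed.

Lemma sum_defect_leqif x :
  \sum_j defect (step l x) j <= \sum_j defect x j ?= iff tight x.
Proof.
have := leqif_sum (fun j (_ : true) => leqif_eq (defect_step x j)).
rewrite !big_split /= (sum_ordS (fun j => waits_prev l x j : nat)).
rewrite (sum_ordS (fun j => waits_next l x j : nat)) [X in _ <= X ?= iff _]addnAC.
by rewrite /leqif !leq_add2r !eqn_add2r.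
Qed.

Lemma sum_gap_leqif x : tight x ->
  \sum_j gap x j <= \sum_j gap (step l x) j ?= iff
  [forall j, gap x j + delayed l x j == gap (step l x) j + delayed l x (ordS j)].
Proof.
move=> tx; have := leqif_sum (fun j (_ : true) => leqif_eq (tight_gap_step j tx)).
rewrite !big_split /= (sum_ordS (fun j => delayed l x j : nat)).
by rewrite /leqif leq_add2r eqn_add2r.
Qed.

(** * Steady orbits and the spreading of waits *)

(** The equation on gaps says that none of them wraps around in the step. *)
Definition steady x : Prop := tight x /\ forall j,
  gap x j + delayed l x j = gap (step l x) j + delayed l x (ordS j).

Definition steady_orbit x : Prop := forall t, steady (state_at l x t).

Lemma state_atD x t s : state_at l x (t + s) = state_at l (state_at l x s) t.
Proof. exact: iterD. Qed.

Lemma steady_orbit_at x t : steady_orbit x -> steady_orbit (state_at l x t).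
Proof. by move=> sx s; rewrite -state_atD. Qed.

(** A small gap excludes waits at the previous node and cannot grow before cluster [j] waits, so
    arriving at cell [0] forces a wait. *)
Lemma waits_next_again x j : steady_orbit x -> gap x j < l ->
  exists t, waits_next l (state_at l x t) j.
Proof.
move: {2}((2 * m - x j) %% (2 * m)) (erefl ((2 * m - x j) %% (2 * m))) => n.
elim: n x => [|n IHn] x dist_x sx gap_lt.
  exists 0; apply: gap_waits_next => //.
  have := ltn_ord (x j); case: (posnP (x j)) => // x_gt0 lt.
  by rewrite modn_small in dist_x; lia.
have [wn|nwn] := boolP (waits_next l x j); first by exists 0.
have [tx gx] : steady x := sx 0.
have nwp : ~~ waits_prev l x j.
  by apply/negP => /(tight_waits_prev tx) []; lia.
have nd : delayed l x j = false by rewrite delayedE (negPf nwn) (negPf nwp).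
have [t wt] : exists t, waits_next l (state_at l (step l x) t) j.
  apply: IHn; last 1 first.
  - by have := gx j; rewrite nd; lia.
  - rewrite val_step nd /succ_mod; have := ltn_ord (x j).
    have x_gt0 : 0 < x j by case: (posnP (x j)) dist_x => // ->; rewrite subn0 modnn.
    rewrite modn_small in dist_x; last by lia.
    case: eqP => [e _|ne lt]; first by rewrite subn0 modnn; lia.
    by rewrite modn_small; lia.
  - exact: steady_orbit_at 1 sx.
by exists (t + 1); rewrite state_atD.
Qed.

Lemma waits_prev_again x j : steady_orbit x -> 2 * m - l < gap x j ->
  exists t, waits_prev l (state_at l x t) (ordS j).
Proof.
(* Number of moves to cell [m]; starting from [3 * m] avoids truncated subtraction. *)
move: {2}((3 * m - x (ordS j)) %% (2 * m))
  (erefl ((3 * m - x (ordS j)) %% (2 * m))) => n.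
elim: n x => [|n IHn] x dist_x sx gap_gt.
  exists 0; apply: gap_waits_prev => //.
  have := ltn_ord (x (ordS j)).
  case: (leqP (x (ordS j)) m) => hx lt.
    case: (ltngtP (x (ordS j)) m) hx => // hx _.
    have E : 3 * m - x (ordS j) = m - x (ordS j) + 2 * m by lia.
    by rewrite E modnDr modn_small in dist_x; lia.
  by rewrite modn_small in dist_x; lia.
have [wp|nwp] := boolP (waits_prev l x (ordS j)); first by exists 0.
have [tx gx] : steady x := sx 0.
have nwn : ~~ waits_next l x (ordS j).
  by apply/negP => /(tight_waits_next tx) []; lia.
have nd : delayed l x (ordS j) = false by rewrite delayedE (negPf nwn) (negPf nwp).
have [t wt] : exists t, waits_prev l (state_at l (step l x) t) (ordS j).
  apply: IHn; last 1 first.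
  - by have := gx j; rewrite nd; lia.
  - rewrite val_step nd /succ_mod; have := ltn_ord (x (ordS j)).
    case: (leqP (x (ordS j)) m) => hx lt.
      have E : 3 * m - x (ordS j) = m - x (ordS j) + 2 * m by lia.
      rewrite E modnDr modn_small in dist_x; last by lia.
      case: eqP => [e|ne]; first by lia.
      have -> : 3 * m - (x (ordS j)).+1 = n + 2 * m by lia.
      by rewrite modnDr modn_small; lia.
    rewrite modn_small in dist_x; last by lia.
    case: eqP => [e|ne]; last by rewrite modn_small; lia.
    have -> : 3 * m - 0 = m + 2 * m by lia.
    by rewrite modnDr modn_small; lia.
  - exact: steady_orbit_at 1 sx.
by exists (t + 1); rewrite state_atD.
Qed.

(** Only a wait of cluster [j] can raise its gap. At the next node the gap is then strictly below
    [l]; at the previous one it would be at least [2 * m - l > l]. *)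
Lemma small_gap_stable x j t : l < m -> steady_orbit x -> gap x j <= l ->
  gap (state_at l x t) j <= l.
Proof.
move=> lt_lm sx gap_le; elim: t => // t IHt.
have [tx gx] := sx t; rewrite [state_at l x t.+1]iterS -/(state_at l x t).
have := gx j; have := @waits_next_gap (state_at l x t) j.
have := @tight_waits_prev (state_at l x t) j tx.
rewrite [delayed l _ j]delayedE.
by case: (waits_next _ _ j); case: (waits_prev _ _ j) => /=; lia.
Qed.

Lemma large_gap_stable x j t : l < m -> steady_orbit x -> 2 * m - l <= gap x j ->
  2 * m - l <= gap (state_at l x t) j.
Proof.
move=> lt_lm sx gap_le; elim: t => // t IHt.
have [tx gx] := sx t; rewrite [state_at l x t.+1]iterS -/(state_at l x t).
have := gx j; have := @waits_prev_gap (state_at l x t) j.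
have := @tight_waits_next (state_at l x t) j tx.
rewrite [delayed l _ (ordS j)]delayedE.
by case: (waits_next _ _ (ordS j)); case: (waits_prev _ _ (ordS j)) => /=; lia.
Qed.

(** A wait lowers the gap on its left from at most [l] to below [l], so the left neighbour waits
    later; gaps already small stay so. *)
Lemma waits_next_spread x j k : l < m -> steady_orbit x -> waits_next l x j ->
  exists t, waits_next l (state_at l x t) (iter k (@ord_pred N) j) /\
    forall s, s <= k -> gap (state_at l x t) (iter s (@ord_pred N) j) <= l.
Proof.
move=> lt_lm sx wj; elim: k => [|k [t [wt small]]].
  by exists 0; split=> // r; rewrite leqn0 => /eqP -> /=; apply/ltnW/waits_next_gap.
have [ty gy] := sx t; set y := state_at l x t in wt small ty gy.
set j' := iter k _ j in wt *.
have [] := @tight_waits_next y (ord_pred j') ty; first by rewrite ord_predK.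
move=> gap_le nd.
have [s ws] : exists s, waits_next l (state_at l (step l y) s) (ord_pred j').
  apply: waits_next_again; first exact: steady_orbit_at t.+1 sx.
  have := gy (ord_pred j'); rewrite ord_predK (negPf nd).
  by rewrite [delayed _ _ j']delayedE wt; lia.
have E : state_at l x (s + t.+1) = state_at l (step l y) s by rewrite state_atD.
exists (s + t.+1); rewrite E; split=> // r; rewrite leq_eqVlt => /predU1P[-> | lt_ik].
  exact/ltnW/waits_next_gap.
by rewrite -E -addSnnS state_atD; apply: small_gap_stable (small _ _) => //;
  apply: steady_orbit_at.
Qed.

Lemma waits_prev_spread x j k : l < m -> steady_orbit x -> waits_prev l x (ordS j) ->
  exists t, waits_prev l (state_at l x t) (ordS (iter k (@ordS N) j)) /\
    forall s, s <= k -> 2 * m - l <= gap (state_at l x t) (iter s (@ordS N) j).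
Proof.
move=> lt_lm sx wj; elim: k => [|k [t [wt large]]].
  by exists 0; split=> // r; rewrite leqn0 => /eqP -> /=; apply/ltnW/waits_prev_gap.
have [ty gy] := sx t; set y := state_at l x t in wt large ty gy.
rewrite [iter k.+1 _ _]iterS; set j' := ordS (iter k _ j) in wt *.
have [gap_ge nd] := tight_waits_prev ty wt.
have [s ws] : exists s, waits_prev l (state_at l (step l y) s) (ordS j').
  apply: waits_prev_again; first exact: steady_orbit_at t.+1 sx.
  have := gy j'; rewrite (negPf nd).
  by rewrite [delayed _ _ j']delayedE wt orbT; lia.
have E : state_at l x (s + t.+1) = state_at l (step l y) s by rewrite state_atD.
exists (s + t.+1); rewrite E; split=> // r; rewrite leq_eqVlt => /predU1P[-> | lt_ik].
  exact/ltnW/waits_prev_gap.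
by rewrite -E -addSnnS state_atD; apply: large_gap_stable (large _ _) => //;
  apply: steady_orbit_at.
Qed.

(** * The sum of the gaps modulo [2 * m] *)

(** The cells cancel around the chain, leaving [N * m]. *)
Lemma dvdn_sum_gap x : ~~ odd N -> 2 * m %| \sum_j gap x j.
Proof.
move=> evenN; rewrite /dvdn.
rewrite -[X in _ == X](mod0n (2 * m)) -(eqn_modDr (\sum_j x j)) add0n -big_split /=.
have -> : \sum_j (gap x j + x j) = \sum_j (x (ordS j) + m) %[mod 2 * m].
  by rewrite -modn_summ -[in RHS]modn_summ; congr (_ %% _); apply: eq_bigr => j _;
    apply: gap_nat_mod.
rewrite big_split /= (sum_ordS (fun j => x j : nat)) sum_nat_const card_ord.
have -> : N * m = N./2 * (2 * m).
  by have := odd_double_half N; rewrite (negPf evenN); nia.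
by rewrite addnC modnMDl.
Qed.

(** The gap of the waiting edge is below [l], so a positive multiple of [2 * m] would be less than
    [N * l]. *)
Lemma not_all_small x i : N * l <= 2 * m -> ~~ odd N -> waits_next l x i ->
  ~ forall j, gap x j <= l.
Proof.
move=> leNl evenN wi small.
have le_sum : \sum_j (gap x j + waits_next l x j) <= \sum_(j < N) l.
  by apply: leq_sum => j _; have := @waits_next_gap x j; have := small j;
    case: waits_next => /=; lia.
rewrite big_split /= sum_nat_const card_ord in le_sum.
have gap_gt0 : 0 < \sum_j gap x j.
  by rewrite (bigD1 i) //=; have := gap_bounds x i; lia.
have w_gt0 : 0 < \sum_j waits_next l x j by rewrite (bigD1 i) //= wi.
have := dvdn_leq gap_gt0 (dvdn_sum_gap x evenN).
by move: le_sum w_gt0; move: (\sum_j gap x j) (\sum_j waits_next _ _ _) => S W; lia.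
Qed.

(** The sum would lie strictly between consecutive multiples of [2 * m]: edge [ord_pred i] exceeds
    [2 * m - l], and tightness keeps edge [i] below [2 * m]. *)
Lemma not_all_large x i : N * l <= 2 * m -> ~~ odd N -> tight x -> waits_prev l x i ->
  ~ forall j, 2 * m - l <= gap x j.
Proof.
move=> leNl evenN tx wi large.
have ge_sum :
    \sum_(j < N) (2 * m - l) + \sum_j waits_prev l x (ordS j) <= \sum_j gap x j.
  rewrite -big_split; apply: leq_sum => j _ /=.
  by have := @waits_prev_gap x j; have := large j; case: waits_prev => /=; lia.
have le_sum : \sum_j (gap x j + waits_prev l x j) <= \sum_(j < N) 2 * m.
  apply: leq_sum => j _; have := @tight_waits_prev x j tx; have := gap_bounds x j.
  by case: waits_prev => /=; lia.
rewrite big_split /= in le_sum.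
rewrite (sum_ordS (fun j => waits_prev l x j : nat)) in ge_sum.
rewrite !sum_nat_const card_ord in le_sum ge_sum.
have w_gt0 : 0 < \sum_j waits_prev l x j by rewrite (bigD1 i) //= wi.
have /dvdnP[k sumE] := dvdn_sum_gap x evenN.
rewrite {}sumE in le_sum ge_sum.
move: le_sum ge_sum w_gt0; move: (\sum_j waits_prev _ _ _) => W le_sum ge_sum w_gt0.
have lt_kN : k < N by rewrite -(@ltn_pmul2r (2 * m)); lia.
have := leq_mul2r (2 * m) k.+1 N; rewrite lt_kN orbT mulSn.
by rewrite mulnBr in ge_sum; lia.
Qed.

Lemma iter_ordS k (i : 'I_N) : iter k (@ordS N) i = (i + k) %% N :> nat.
Proof.
elim: k => [|k IHk]; first by rewrite addn0 modn_small.
by rewrite iterS /= IHk -addn1 modnDml addn1 addnS.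
Qed.

Lemma ordS_connected (i j : 'I_N) : exists2 k, k <= 2 * N & iter k (@ordS N) i = j.
Proof.
exists (N - i + j); first by have := ltn_ord j; lia.
apply: val_inj; rewrite /= iter_ordS.
have -> : i + (N - i + j) = j + N by have := ltn_ord i; lia.
by rewrite modnDr modn_small.
Qed.

Lemma iter_ordSK k : cancel (iter k (@ordS N)) (iter k (@ord_pred N)).
Proof. by elim: k => // k IHk i; rewrite iterSr iterS ordSK IHk. Qed.

Lemma steady_orbit_free x : N * l <= 2 * m -> 2 <= N -> ~~ odd N -> steady_orbit x ->
  forall i, ~~ delayed l x i.
Proof.
move=> leNl N_ge2 evenN sx i; rewrite delayedE negb_or.
have [tx _] : steady x := sx 0.
(* If l = m, the gap m is both small and large and its side need not persist,
   but then N = 2 and the two edges at the waiting cluster are all of them. *)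
have two_contours : l = m -> forall j j' : 'I_N, j' != j -> j' = ordS j.
  move=> eq_lm j j' ne; apply: val_inj => /=.
  have N2 : N = 2 by nia.
  move: j j' ne; rewrite N2 => j j' /eqP ne.
  have {}ne : j' <> j :> nat by move=> e; apply/ne/val_inj.
  by have := ltn_ord j; have := ltn_ord j'; lia.
case: (ltngtP l m) => [lt_lm|gt_lm|eq_lm]; last 2 first.
- by lia.
- apply/andP; split; apply/negP => wi.
    apply: (@not_all_small x i) => // j.
    have [->|ne] := eqVneq j i; first exact/ltnW/waits_next_gap.
    have ei : i = ordS j by apply: two_contours; rewrite 1?eq_sym.
    by have [] := @tight_waits_next x j tx; rewrite -?ei.
  apply: (@not_all_large x i) => // j.
  have [->|ne] := eqVneq j i; first by have [/andP[]] := tight_waits_prev tx wi.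
  have ei : i = ordS j by apply: two_contours; rewrite 1?eq_sym.
  by apply/ltnW/waits_prev_gap; rewrite -ei.
apply/andP; split; apply/negP => wi.
  (* [2 * N] rounds suffice to reach every edge, by [ordS_connected]. *)
  have [t [wt small]] := waits_next_spread (2 * N) lt_lm sx wi.
  apply: not_all_small wt _ => // j.
  have [k le_k e] := ordS_connected j i.
  by rewrite -(iter_ordSK k j) e; apply: small.
rewrite -[i]ord_predK in wi.
have [t [wt large]] := waits_prev_spread (2 * N) lt_lm sx wi.
have [ty _] := sx t.
apply: not_all_large wt _ => // j.
by have [k le_k <-] := ordS_connected (ord_pred i) j; apply: large.
Qed.

End Dynamics.

(** * Reaching a steady orbit *)

Lemma nonincreasing_eventually_constant (u : nat -> nat) :
  (forall t, u t.+1 <= u t) -> exists T, forall t, u (t + T) = u T.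
Proof.
have [n] := ubnP (u 0); elim: n u => // n IHn u lt_u0 decr.
(* Descent on [u 0]: restart at a smaller value or, if none exists, [u] is constant. *)
have [[s lt_us]|const] := classic (exists s, u s < u 0).
  have [|t|T constT] := IHn (fun t => u (t + s)); first by rewrite add0n; lia.
    exact: decr.
  by exists (T + s) => t; rewrite addnA constT.
exists 0 => t; rewrite addn0; apply/eqP; rewrite eqn_leq.
have -> : u 0 <= u t by rewrite leqNgt; apply/negP => lt; apply: const; exists t.
by rewrite andbT; elim: t => // t IHt; apply: leq_trans (decr t) IHt.
Qed.

Lemma eventually_steady (N m l : nat) (x : state N m) : 0 < l -> l <= m ->
  exists T, steady_orbit l (state_at l x T).
Proof.
move=> l_gt0 le_lm.
pose B t := \sum_j defect l (state_at l x t) j.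
pose S t := \sum_j gap (state_at l x t) j.
have [t|T1 constB] := nonincreasing_eventually_constant (u := B).
  by have [] := sum_defect_leqif l_gt0 le_lm (state_at l x t).
have tight1 t : tight l (state_at l x (t + T1)).
  have [_ <-] := sum_defect_leqif l_gt0 le_lm (state_at l x (t + T1)).
  exact/eqP/(etrans (constB t.+1))/esym/constB.
have le_S t : S t <= N * (2 * m).
  rewrite -[N in N * _]card_ord -sum_nat_const; apply: leq_sum => j _.
  by have /andP[] := gap_bounds (state_at l x t) j.
have gapS t := sum_gap_leqif l_gt0 le_lm (tight1 t).
(* Subtracting from the upper bound turns the nondecreasing gap sum into a nonincreasing
   sequence. *)
have [t|T2 constS] := nonincreasing_eventually_constant
    (u := fun t => N * (2 * m) - S (t + T1)).
  by apply: leq_sub2l; have [] := gapS t.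
exists (T2 + T1) => t; rewrite -state_atD addnA; split; first exact: tight1.
have eqS : S (t + T2 + T1) = S (t.+1 + T2 + T1).
  have := constS t; have := constS t.+1.
  by have := le_S (t.+1 + T2 + T1); have := le_S (t + T2 + T1); lia.
have [_] := gapS (t + T2); rewrite [X in X == _]eqS eqxx => /esym/forallP eq_gap j.
exact/eqP/eq_gap.
Qed.

Theorem theorem11 (N m l : nat) (hN : 2 <= N) (hm : 1 <= m)
    (hl : 1 <= l < 2 * m) (evenN : ~~ odd N)
    (hlN : (l%:R <= (2 * m)%:R / N%:R :> rat)%R)
    (x : state N m) (hx : admissible l x) :
  exists t0 : nat, free_movement_at l x t0.
Proof.
have leNl : N * l <= 2 * m.
  rewrite ler_pdivlMr ?ltr0n in hlN; last by lia.
  by rewrite -natrM ler_nat mulnC in hlN.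
have [l_gt0 _] := andP hl; have le_lm : l <= m by nia.
have [T sT] := eventually_steady x l_gt0 le_lm.
exists T => t le_Tt; rewrite -(subnK le_Tt) state_atD.
exact: steady_orbit_free (steady_orbit_at _ sT).
Qed.
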